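(* Let $Y\subseteq\mathbb{Z}^n$ be any digital image, let $N\ge 1$, and let $\alpha\colon I_N\to Y$ be a path of length $N$ in $Y$. For any odd $2k+1\ge 3$ there is a canonical choice of map of subdivisions $$\widehat{\alpha}\colon S(I_N,2k+1)=I_{N(2k+1)+2k}\to S(Y,2k+1)$$ that covers the given path, in the sense that $$\rho_{2k+1}\circ\widehat{\alpha}=\alpha\circ\rho_{2k+1}\colon S(I_N,2k+1)\to Y.$$
   Context: A digital image (of dimension $n$) is a finite subset $X\subseteq\mathbb{Z}^n$ with the adjacency relation: $x\sim_X y$ iff $|x_i-y_i|\le 1$ for every $i=1,\dots,n$ (so each point is adjacent to itself). A function $f\colon X\to Y$ of digital images is continuous if $x\sim_X x'$ implies $f(x)\sim_Y f(x')$; a map means a continuous function. $I_N=\{0,1,\dots,N\}\subseteq\mathbb{Z}$ is the digital interval of length $N$. A path of length $N\ge1$ in $Y$ is a continuous map $I_N\to Y$. For $X\subseteq\mathbb{Z}^n$ a digital image and an integer $m\ge2$, the $m$-subdivision of $X$ is $S(X,m)=\{(y_1,\dots,y_n)\in\mathbb{Z}^n \mid (\lfloor y_1/m\rfloor,\dots,\lfloor y_n/m\rfloor)\in X\}$, and the standard projection is the (continuous) map $\rho_m\colon S(X,m)\to X$, $\rho_m(y_1,\dots,y_n)=(\lfloor y_1/m\rfloor,\dots,\lfloor y_n/m\rfloor)$. In particular $S(I_N,m)=I_{Nm+m-1}$. The word ''canonical'' is used informally; the mathematical assertion is the existence of the continuous map $\widehat\alpha$ with the stated property. *)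

(* Defs.v *)
From HB Require Import structures.
From mathcomp Require Import all_boot all_order all_algebra.
From mathcomp Require Import finmap zify.

Set Implicit Arguments.
Unset Strict Implicit.
Unset Printing Implicit Defensive.

Import Order.TTheory GRing.Theory Num.Theory.

Local Open Scope fset_scope.
Local Open Scope ring_scope.

(* Points of Z^n are integer row vectors. *)
Definition digital_image (n : nat) := {fset 'rV[int]_n}.

Definition adjacent (n : nat) (x y : 'rV[int]_n) : bool :=
  [forall i, `|x 0 i - y 0 i| <= 1].

(* Functions of digital images go between the finite subtypes [X] and [Y]. *)
Definition dcontinuous (n p : nat) (X : digital_image n) (Y : digital_image p)
    (f : X -> Y) : Prop :=
  forall x x' : X, adjacent (val x) (val x') -> adjacent (val (f x)) (val (f x')).

(* {0, ..., N}, as a subset of Z = Z^1. *)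
Definition digital_interval (N : nat) : digital_image 1 :=
  [fset (const_mx t%:Z : 'rV[int]_1) | t in iota 0 N.+1].

(* For m > 0, [divz] by m rounds towards -oo, so this is y |-> floor(y_i / m). *)
Definition floor_div (n m : nat) (y : 'rV[int]_n) : 'rV[int]_n :=
  \row_i (y 0%R i %/ m%:Z)%Z.

(* The finite set of all y with floor_div m y in X, listed as the points
   m * x + r with x in X and 0 <= r_i < m; see [in_subdivision]. *)
Definition subdivision (n : nat) (X : digital_image n) (m : nat) :
    digital_image n :=
  [fset (\row_i (m%:Z * x 0 i + (r i : nat)%:Z))
     | x : 'rV[int]_n in X, r : {ffun 'I_n -> 'I_m} in {: {ffun 'I_n -> 'I_m}}].

Lemma floor_div_subdivision (n m : nat) (X : digital_image n) (y : 'rV[int]_n) :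
  y \in subdivision X m -> floor_div m y \in X.
Proof.
case/imfset2P=> x /= xX [r _ ->]; suff -> : floor_div m (\row_i (m%:Z * x 0 i + (r i : nat)%:Z)) = x :> 'rV[int]_n by [].
apply/rowP=> i; rewrite !mxE; have r_lt := ltn_ord (r i).
have m_neq0 : m%:Z != 0 by lia.
by rewrite (mulrC m%:Z) divzMDl // divz_small ?addr0 //; lia.
Qed.

Lemma in_subdivision (n m : nat) (X : digital_image n) (y : 'rV[int]_n) :
  (0 < m)%N -> (y \in subdivision X m) = (floor_div m y \in X).
Proof.
move=> m_gt0; apply/idP/idP; first exact: floor_div_subdivision.
move=> fyX; apply/imfset2P; exists (floor_div m y) => //.
have m_neq0 : m%:Z != 0 by lia.
have mod_lt i : (`|(y 0%R i %% m%:Z)%Z| < m)%N.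
  have m_gt0' : 0 < m%:Z by lia.
  by have := modz_ge0 (y 0 i) m_neq0; have := ltz_pmod (y 0 i) m_gt0'; lia.
exists [ffun i => Ordinal (mod_lt i)] => //.
apply/rowP=> i; rewrite !mxE ffunE /= gez0_abs ?modz_ge0 //.
by rewrite mulrC -divz_eq.
Qed.

Lemma in_digital_interval (N : nat) (y : 'rV[int]_1) :
  (y \in digital_interval N) = (0 <= y 0 0 <= N%:Z).
Proof.
have in_iota t : (t \in mem_fin (fin_finpred (iota 0 N.+1))) = (t <= N)%N.
  by rewrite -[LHS]/(t \in iota 0 N.+1) mem_iota.
apply/imfsetP/idP => [[t]|y_bd].
  by rewrite in_iota => t_in ->; rewrite mxE; lia.
exists `|y 0%R 0%R|%N; first by rewrite in_iota; lia.
apply/rowP=> i; rewrite mxE ord1 gez0_abs //.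
by case/andP: y_bd.
Qed.

Lemma subdivision_digital_interval (N m : nat) :
  (0 < m)%N ->
  subdivision (digital_interval N) m = digital_interval (N * m + m - 1).
Proof.
move=> m_gt0; apply/fsetP=> y; rewrite in_subdivision // !in_digital_interval mxE.
have m_gt0' : 0 < m%:Z by lia.
have m_neq0 : m%:Z != 0 by lia.
have := ltz_pmod (y 0 0) m_gt0'; have := modz_ge0 (y 0 0) m_neq0.
have := divz_eq (y 0 0) m%:Z.
move: (divz _ _) (modz _ _) => q r -> r_ge0 r_lt.
apply/idP/idP => /andP[]; nia.
Qed.

Definition rho (n m : nat) (X : digital_image n) (y : subdivision X m) : X :=
  [` floor_div_subdivision (valP y)].

Lemma rho_continuous (n m : nat) (X : digital_image n) :
  dcontinuous (@rho n m X).
Proof.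
move=> x x' /forallP adj; apply/forallP=> i; move: (adj i); rewrite !mxE.
move: (val x 0 i) (val x' 0 i) => a b.
case: m {x x' adj} => [|m]; first by rewrite !divz0.
have m_gt0 : 0 < m.+1%:Z by [].
have m_neq0 : m.+1%:Z != 0 by [].
have := ltz_pmod a m_gt0; have := modz_ge0 a m_neq0.
have := ltz_pmod b m_gt0; have := modz_ge0 b m_neq0.
have := divz_eq a m.+1%:Z; have := divz_eq b m.+1%:Z.
move: (divz a _) (divz b _) (modz a _) (modz b _) => q q' r r'.
by nia.
Qed.

(* Main.v *)
Require Import Defs.
From mathcomp Require Import all_boot all_order all_algebra.
From mathcomp Require Import finmap.
From mathcomp Require Import zify.

(** Write m = 2k + 1.  As m is odd, the block of the m ^ n points of the
    subdivision lying over a point y has an exact centre, m y + k in each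
    coordinate, and the cover is the linear interpolation between centres: it
    sends the centre m q + k of the q-th block of the subdivided interval to the
    centre over alpha(q), and between two consecutive centres, which are m steps
    apart, it moves at every step by alpha(q + 1) - alpha(q).  The entries of
    this difference are -1, 0 or 1 because alpha is continuous, so the interpolated
    path is continuous ([interpolate_adjacent]); and m such steps lead exactly
    from one centre to the next, so the pieces fit together.

    It covers alpha because a point of the q-th block is at most k steps away
    from the centre of that block, so its image differs by at most k in each
    coordinate from the centre over alpha(q): it stays within the block over
    alpha(q) ([floor_div_interpolate]).

    The first k and the last k points of the subdivided interval have a centre on
    one side only.  Extending alpha to all integers by its two end values,
    through [clamp], makes the same formula constant there. *)

Set Implicit Arguments.
Unset Strict Implicit.
Unset Printing Implicit Defensive.

Import Order.TTheory GRing.Theory Num.Theory.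

Local Open Scope fset_scope.
Local Open Scope ring_scope.

(** The quotient of t - k, rather than of t, by 2k + 1 is the index of the last
    centre up to t, and the remainder is the number of steps made since then. *)
Definition interpolate (n k : nat) (a : int -> 'rV[int]_n) (t : int) :
    'rV[int]_n :=
  let m := (2 * k + 1)%N%:Z in
  let q := ((t - k%:Z) %/ m)%Z in
  let s := ((t - k%:Z) %% m)%Z in
  \row_i (m * a q 0 i + k%:Z + s * (a (q + 1) 0 i - a q 0 i)).

Lemma divz_unique (m t q s : int) :
  0 <= s < m -> t = q * m + s -> (t %/ m)%Z = q /\ (t %% m)%Z = s.
Proof.
move=> s_bd ->; have m_neq0 : m != 0 by lia.
by rewrite modzMDl divzMDl // divz_small ?modz_small ?addr0 //; lia.
Qed.

(** The bound on s includes m = 2k + 1, where the formula of one piece gives the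
    first value of the next: this is the agreement of consecutive pieces. *)
Lemma interpolateE (n k : nat) (a : int -> 'rV[int]_n) (q s : int) i :
  0 <= s <= (2 * k + 1)%N%:Z ->
  interpolate k a (q * (2 * k + 1)%N%:Z + k%:Z + s) 0 i =
    (2 * k + 1)%N%:Z * a q 0 i + k%:Z + s * (a (q + 1) 0 i - a q 0 i).
Proof.
rewrite /interpolate mxE; set m := (2 * k + 1)%N%:Z => s_bd.
have [->|s_neq] := eqVneq s m.
  by have [||-> ->] := @divz_unique m (q * m + k%:Z + m - k%:Z) (q + 1) 0; lia.
by have [||-> ->] // := @divz_unique m (q * m + k%:Z + s - k%:Z) q s; lia.
Qed.

Lemma centre_decomp (k : nat) (t : int) :
  exists q s : int,
    0 <= s < (2 * k + 1)%N%:Z /\ t = q * (2 * k + 1)%N%:Z + k%:Z + s.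
Proof.
set m := (2 * k + 1)%N%:Z; have m_gt0 : 0 < m by lia.
exists ((t - k%:Z) %/ m)%Z, ((t - k%:Z) %% m)%Z; split.
  by rewrite modz_ge0 ?ltz_pmod //; lia.
by have := divz_eq (t - k%:Z) m; lia.
Qed.

Lemma adjacent_refl (n : nat) (x : 'rV[int]_n) : adjacent x x.
Proof. by apply/forallP=> i; rewrite subrr normr0. Qed.

Lemma adjacent_sym (n : nat) (x y : 'rV[int]_n) : adjacent x y -> adjacent y x.
Proof. by move=> /forallP xy; apply/forallP=> i; rewrite distrC. Qed.

Section PathOnIntegers.

Variables (n k : nat) (a : int -> 'rV[int]_n).
Hypothesis a_path : forall q, adjacent (a q) (a (q + 1)).

Lemma interpolate_succ (t : int) :
  adjacent (interpolate k a t) (interpolate k a (t + 1)).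
Proof.
have [q [s [s_bd ->]]] := centre_decomp k t.
apply/forallP=> i; rewrite -(addrA _ s) !interpolateE; try lia.
by have /forallP/(_ i) := a_path q; rewrite mulrDl; lia.
Qed.

Lemma interpolate_adjacent (t t' : int) :
  `|t - t'| <= 1 -> adjacent (interpolate k a t) (interpolate k a t').
Proof.
move=> tt'; have [->|[->|->]] : t' = t \/ t' = t + 1 \/ t = t' + 1 by lia.
- exact: adjacent_refl.
- exact: interpolate_succ.
- exact/adjacent_sym/interpolate_succ.
Qed.

Lemma floor_div_interpolate (t : int) :
  floor_div (2 * k + 1) (interpolate k a t) = a (t %/ (2 * k + 1)%N%:Z)%Z.
Proof.
have [q [s [s_bd ->]]] := centre_decomp k t.
apply/rowP=> i; rewrite mxE interpolateE; last by lia.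
have /forallP/(_ i) := a_path q; set m := (2 * k + 1)%N%:Z in s_bd *.
move=> a_adj; have [s_le|s_gt] := leP s k%:Z.
  have [||-> _] := @divz_unique m (q * m + k%:Z + s) q (k%:Z + s); try lia.
  by apply: (proj1 (@divz_unique _ _ _
       (k%:Z + s * (a (q + 1) 0 i - a q 0 i)) _ _)); nia.
(* Past the midpoint the nearest centre is the next one, m - s steps ahead. *)
have [||-> _] := @divz_unique m (q * m + k%:Z + s) (q + 1) (s - k%:Z - 1);
  try lia.
by apply: (proj1 (@divz_unique _ _ _
     (k%:Z - (m - s) * (a (q + 1) 0 i - a q 0 i)) _ _)); nia.
Qed.

End PathOnIntegers.

Definition clamp (N : nat) (q : int) : int := Num.min (Num.max q 0) N%:Z.

Lemma clamp_in (N : nat) (q : int) :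
  const_mx (clamp N q) \in digital_interval N.
Proof. by rewrite in_digital_interval mxE /clamp; lia. Qed.

Definition extend_path (n : nat) (Y : digital_image n) (N : nat)
    (alpha : digital_interval N -> Y) (q : int) : Y :=
  alpha [` clamp_in N q].

Lemma extend_path_adjacent (n : nat) (Y : digital_image n) (N : nat)
    (alpha : digital_interval N -> Y) (q : int) :
  dcontinuous alpha ->
  adjacent (val (extend_path alpha q)) (val (extend_path alpha (q + 1))).
Proof.
apply; apply/forallP=> i /=; rewrite !mxE /clamp; lia.
Qed.

Lemma extend_pathE (n : nat) (Y : digital_image n) (N : nat)
    (alpha : digital_interval N -> Y) (x : digital_interval N) :
  extend_path alpha (val x 0 0) = alpha x.
Proof.
congr (alpha _); apply/val_inj/rowP=> i /=; rewrite mxE ord1.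
by have := valP x; rewrite in_digital_interval /clamp /=; lia.
Qed.

Theorem theorem4p1 (n : nat) (Y : digital_image n) (N : nat) (hN : (1 <= N)%N)
    (alpha : digital_interval N -> Y) (halpha : dcontinuous alpha)
    (k : nat) (hk : (3 <= 2 * k + 1)%N) :
  subdivision (digital_interval N) (2 * k + 1)
    = digital_interval (N * (2 * k + 1) + 2 * k) /\
  exists alphahat :
      subdivision (digital_interval N) (2 * k + 1) -> subdivision Y (2 * k + 1),
    dcontinuous alphahat /\
    (@rho n (2 * k + 1) Y) \o alphahat
      =1 alpha \o (@rho 1 (2 * k + 1) (digital_interval N)).
Proof.
have m_gt0 : (0 < 2 * k + 1)%N by lia.
split; first by rewrite subdivision_digital_interval // addnA addnK.
pose a q := val (extend_path alpha q).
have a_path q : adjacent (a q) (a (q + 1)) by exact: extend_path_adjacent.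
have hat_in t : interpolate k a t \in subdivision Y (2 * k + 1).
  by rewrite in_subdivision // floor_div_interpolate // /a fsvalP.
exists (fun x : subdivision (digital_interval N) (2 * k + 1) =>
          [` hat_in (val x 0 0)]); split.
  by move=> x x' /forallP/(_ 0) xx'; exact: interpolate_adjacent.
move=> x; apply: val_inj; rewrite /= floor_div_interpolate //.
by rewrite /a -[alpha _]extend_pathE /= mxE.
Qed.
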